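(* Let $X=(X,\phi,\varepsilon(X))$ be an exterior discrete semi-flow. Then: (i) $D(X)\subset \bar D(X)\subset \mathrm{PA}(\bar L(X))$; (ii) if $(X,\phi)$ is Lagrange stable at every point of $\bar D(X)$, then $\bar D(X)\subset \mathrm{A}(\bar L(X))$; (iii) if $(X,\phi)$ is Lagrange stable at every point of $\mathrm{A}(L(X))$, then $\mathrm{A}(L(X))\subset D(X)$; (iv) if $(X,\phi)$ is Lagrange stable at every point of $\mathrm{PA}(L(X))$, then $\mathrm{PA}(L(X))\subset D(X)$; (v) if $(X,\phi)$ is Lagrange stable at every point of $\mathrm{PA}(L(X))$ and $L(X)=\bar L(X)$, then $D(X)=\mathrm{PA}(L(X))=\mathrm{A}(L(X))$.
   Context: $\mathbb{N}=\{0,1,2,\dots\}$. An externology on a topological space $X$ is a non-empty collection $\varepsilon(X)$ of open subsets of $X$, closed under finite intersections, such that if $E\in\varepsilon(X)$ and $U$ is open with $E\subset U$, then $U\in\varepsilon(X)$. A topological space with an externology is an exterior space. A map $f$ from $(X,\varepsilon(X))$ to $(X',\varepsilon(X'))$ is exterior if it is continuous and $f^{-1}(E')\in\varepsilon(X)$ for all $E'\in\varepsilon(X')$. $\mathbb{N}$ is regarded as an exterior space with the discrete topology and the externology of all complements of finite sets. A discrete semi-flow on a topological space $X$ is a continuous map $\phi\colon\mathbb{N}\times X\to X$ with $\phi(0,x)=x$ and $\phi(n,\phi(m,x))=\phi(n+m,x)$; write $\phi^n(x)=n\cdot x=\phi_x(n)=\phi(n,x)$. An exterior discrete semi-flow $(X,\phi,\varepsilon(X))$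 is an exterior space $(X,\varepsilon(X))$ with a discrete semi-flow $\phi$ such that $\phi^1\colon X\to X$ is exterior. Limit space: $L(X)=\bigcap_{E\in\varepsilon(X)}E$; bar-limit space: $\bar L(X)=\bigcap_{E\in\varepsilon(X)}\overline{E}$. $D(X)=\{x\in X\mid \phi_x\colon\mathbb{N}\to X \text{ is exterior}\}$; equivalently, $x\in D(X)$ iff for every $E\in\varepsilon(X)$ there is $n_E$ with $\phi^n(x)\in E$ for all $n\ge n_E$. $\bar D(X)$ is the set of $x\in X$ such that for every $E\in\varepsilon(X)$ there is $n_E\in\mathbb{N}$ with $\phi^n(x)\in\overline{E}$ for all $n\ge n_E$. Omega-limit: $\Lambda(x)=\bigcap_{n\ge 0}\overline{\{m\cdot x\mid m\ge n\}}$. For $S\subset X$: $\mathrm{PA}(S)=\{x\in X\mid\Lambda(x)\subset S\}$ and $\mathrm{A}(S)=\{x\in X\mid\emptyset\neq\Lambda(x)\subset S\}$. $(X,\phi)$ is Lagrange stable at $x$ if $\overline{\mathbb{N}\cdot x}=\overline{\{n\cdot x\mid n\in\mathbb{N}\}}$ is compact. *)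

(* Defs.v *)
From mathcomp Require Import all_boot all_order all_algebra.
From mathcomp Require Import all_classical all_reals all_analysis.

Set Implicit Arguments.
Unset Strict Implicit.
Unset Printing Implicit Defensive.

Local Open Scope classical_set_scope.

(* Since eps is non-empty and upward closed, it contains setT, the empty
   intersection; closure under finite intersections thus reduces to closure
   under binary ones. *)
Record externology (X : topologicalType) (eps : set_system X) : Prop :=
  Externology {
    ext_nonempty : eps !=set0;
    ext_open : forall E : set X, eps E -> open E;
    ext_setI : forall E F : set X, eps E -> eps F -> eps (E `&` F);
    ext_up : forall E U : set X, eps E -> open U -> E `<=` U -> eps U }.

Definition exterior_map (X X' : topologicalType)
    (eps : set_system X) (eps' : set_system X') (f : X -> X') : Prop :=
  continuous f /\ forall E' : set X', eps' E' -> eps (f @^-1` E').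

Definition cofinite_ext : set_system nat := [set A | finite_set (~` A)].

(* The topology on nat * X is the product one, with nat discrete. *)
Record semiflow (X : topologicalType) (phi : nat -> X -> X) : Prop :=
  Semiflow {
    semiflow_continuous : continuous (fun p : nat * X => phi p.1 p.2);
    semiflow0 : forall x : X, phi 0 x = x;
    semiflowD : forall (n m : nat) (x : X), phi n (phi m x) = phi (n + m) x }.

Record exterior_semiflow (X : topologicalType) (phi : nat -> X -> X)
    (eps : set_system X) : Prop :=
  ExteriorSemiflow {
    exterior_semiflow_externology : externology eps;
    exterior_semiflow_semiflow : semiflow phi;
    exterior_semiflow_map : exterior_map eps eps (phi 1) }.

Section ExteriorSemiflow.
Variables (X : topologicalType) (phi : nat -> X -> X) (eps : set_system X).

Definition limit_space : set X := \bigcap_(E in eps) E.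

Definition bar_limit_space : set X := \bigcap_(E in eps) closure E.

Definition D_region : set X :=
  [set x | exterior_map cofinite_ext eps (fun n : nat => phi n x)].

Definition barD_region : set X :=
  [set x | forall E : set X, eps E ->
     exists nE : nat, forall n : nat, (nE <= n)%N -> closure E (phi n x)].

Definition omega_limit (x : X) : set X :=
  \bigcap_(n in [set: nat]) closure [set phi m x | m in [set m | (n <= m)%N]].

Definition PA_region (S : set X) : set X := [set x | omega_limit x `<=` S].

Definition A_region (S : set X) : set X :=
  [set x | omega_limit x !=set0 /\ omega_limit x `<=` S].

Definition lagrange_stable_at (x : X) : Prop :=
  compact (closure (range (fun n : nat => phi n x))).

End ExteriorSemiflow.

Lemma externology_cofinite_ext : externology cofinite_ext.
Proof.
split.
- by exists setT; rewrite /cofinite_ext /= setCT.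
- by move=> E _; exact: discrete_open.
- by move=> E F fE fF; rewrite /cofinite_ext /= setCI finite_setU.
- move=> E U fE _ EU; apply: sub_finite_set fE; exact: subsetC.
Qed.

(* Main.v *)
Require Import Defs.
From mathcomp Require Import all_boot all_order all_algebra.
From mathcomp Require Import all_classical all_reals all_analysis.

(** The omega-limit of [x] is the cluster set of the sequence [phi n x] along
    the filter of neighbourhoods of infinity, and a point of [D] (resp.
    [barD]) is one whose orbit is eventually in every exterior open set [E]
    (resp. in its closure).  All the inclusions are then instances of three
    facts about filters.

    - If a filter contains the closed set [closure E], all its cluster points
      lie in [closure E] ([barD_regionS_PA]).
    - A proper filter that contains a compact set has a cluster point
      ([lagrange_omega_limit_neq0]); this turns [PA] into [A].
    - A filter that contains a compact set contains every open set that
      contains all its cluster points ([compact_cluster_open]).  Exterior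
      sets are open and contain the limit space, so the orbit of a Lagrange
      stable point whose omega-limit lies in the limit space is eventually in
      every exterior set ([lagrange_PA_D]).

    When [L] and [barL] coincide these inclusions close up into a cycle. *)

Local Open Scope classical_set_scope.

(** The trace of [F] on the complement of [U] is again a filter; were it
    proper, compactness would give it a cluster point, which is a cluster
    point of [F] lying in the closed set [~` U]. *)
Lemma compact_cluster_open (X : topologicalType) (F : set_system X)
    (K U : set X) :
  Filter F -> compact K -> F K -> open U -> cluster F `<=` U -> F U.
Proof.
move=> FF cK FK oU clU; apply: contrapT => nFU.
have FG : ProperFilter (within (~` U) F).
  apply: Build_ProperFilter_ex => P; rewrite /within /= => FP.
  apply: contrapT => nP; apply: nFU.
  apply: filterS FP => y UP; apply: contrapT => nUy.
  by apply: nP; exists y; exact: UP.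
have GF : F `<=` within (~` U) F by move=> A FA; exact: filterS FA.
have [y [_ yG]] := cK _ FG (GF _ FK).
have yF : cluster F y by exact: cvg_cluster yG.
have : closure (~` U) y.
  by move: yG; rewrite clusterE; apply; exact: withinT.
rewrite -(closure_id _).1; last exact: open_closedC.
by apply; exact: clU.
Qed.

Lemma cofinite_ext_eventually (A : set nat) :
  cofinite_ext A <-> \forall n \near \oo, A n.
Proof.
split=> [/finite_seqP[s As]|[N _ NA]].
- exists (\max_(i <- s) i).+1 => // n /= sn; apply: contrapT => nAn.
  have ns : n \in s by have : [set` s] n by rewrite -As.
  by have := @leq_bigmax_seq _ s xpredT id n ns isT; rewrite leqNgt sn.
- apply: sub_finite_set (finite_II N) => n nAn /=.
  by rewrite ltnNge; apply/negP => Nn; apply: nAn; exact: NA.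
Qed.

(** Every map out of the discrete space [nat] is continuous, so only the
    condition on preimages matters. *)
Lemma D_regionP (X : topologicalType) (phi : nat -> X -> X)
    (eps : set_system X) (x : X) :
  D_region phi eps x <-> forall E, eps E -> \forall n \near \oo, E (phi n x).
Proof.
split=> [[_ phiE] E eE|phiE].
  by apply/cofinite_ext_eventually; exact: phiE.
split=> [n A nA|E eE]; last by apply/cofinite_ext_eventually; exact: phiE.
by apply: (filterS _ (discrete_set1 n)) => m ->; exact: nbhs_singleton nA.
Qed.

Lemma omega_limit_cluster (X : topologicalType) (phi : nat -> X -> X) (x : X) :
  omega_limit phi x = cluster ((fun n => phi n x) @ \oo).
Proof.
rewrite clusterE; apply/seteqP; split=> y omy.
- move=> A [N _ NA]; apply: closureS (omy N I) => _ [m /= Nm <-].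
  exact: NA.
- by move=> n _; apply: omy; exists n => // m nm; exists m.
Qed.

Lemma D_regionS_barD (X : topologicalType) (phi : nat -> X -> X)
    (eps : set_system X) : D_region phi eps `<=` barD_region phi eps.
Proof.
move=> x /D_regionP Dx E /Dx[N _ NE]; exists N => n Nn.
by apply: subset_closure; exact: NE.
Qed.

Lemma barD_regionS_PA (X : topologicalType) (phi : nat -> X -> X)
    (eps : set_system X) :
  barD_region phi eps `<=` PA_region phi (bar_limit_space eps).
Proof.
move=> x bDx y; rewrite omega_limit_cluster clusterE => omy E /bDx[N NE].
rewrite ((closure_id (closure E)).1 (@closed_closure _ E)).
by apply: omy; exists N => // n; exact: NE.
Qed.

(** The orbit lies in its closure, so the compactness granted by Lagrange
    stability applies to the filter of its tails. *)
Lemma orbit_closure_eventually (X : topologicalType) (phi : nat -> X -> X)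
    (x : X) :
  ((fun n => phi n x) @ \oo) (closure (range (fun n => phi n x))).
Proof. by exists 0 => // n _; apply: subset_closure; exists n. Qed.

Lemma lagrange_omega_limit_neq0 (X : topologicalType) (phi : nat -> X -> X)
    (x : X) : lagrange_stable_at phi x -> omega_limit phi x !=set0.
Proof.
move=> cx; have [y [_ omy]] := cx _ _ (orbit_closure_eventually _ phi x).
by exists y; rewrite omega_limit_cluster.
Qed.

Lemma lagrange_PA_D (X : topologicalType) (phi : nat -> X -> X)
    (eps : set_system X) (x : X) :
  externology eps -> lagrange_stable_at phi x ->
  PA_region phi (limit_space eps) x -> D_region phi eps x.
Proof.
move=> He cx PAx; apply/D_regionP => E eE.
apply: (compact_cluster_open _ _ _ E _ cx (orbit_closure_eventually _ phi x)).
  exact: ext_open eE.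
by rewrite -omega_limit_cluster => y /PAx; apply.
Qed.

Theorem theorem5p1 (X : topologicalType) (phi : nat -> X -> X)
    (eps : set_system X) (Hphi : exterior_semiflow phi eps) :
  [/\ D_region phi eps `<=` barD_region phi eps /\
      barD_region phi eps `<=` PA_region phi (bar_limit_space eps),
      (forall x : X, barD_region phi eps x -> lagrange_stable_at phi x) ->
        barD_region phi eps `<=` A_region phi (bar_limit_space eps),
      (forall x : X, A_region phi (limit_space eps) x -> lagrange_stable_at phi x) ->
        A_region phi (limit_space eps) `<=` D_region phi eps,
      (forall x : X, PA_region phi (limit_space eps) x -> lagrange_stable_at phi x) ->
        PA_region phi (limit_space eps) `<=` D_region phi eps
    & (forall x : X, PA_region phi (limit_space eps) x -> lagrange_stable_at phi x) ->
        limit_space eps = bar_limit_space eps ->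
        D_region phi eps = PA_region phi (limit_space eps) /\
        PA_region phi (limit_space eps) = A_region phi (limit_space eps)].
Proof.
have He := exterior_semiflow_externology Hphi.
split.
- by split; [exact: D_regionS_barD|exact: barD_regionS_PA].
- move=> lag x bDx; split; last exact: barD_regionS_PA.
  exact: lagrange_omega_limit_neq0 (lag _ bDx).
- by move=> lag x Ax; apply: lagrange_PA_D (lag _ Ax) _ => //; case: Ax.
- by move=> lag x PAx; exact: lagrange_PA_D (lag _ PAx) PAx.
- move=> lag LbarL; split; apply/seteqP; split=> x.
  + by rewrite LbarL => /D_regionS_barD; exact: barD_regionS_PA.
  + by move=> PAx; exact: lagrange_PA_D (lag _ PAx) PAx.
  + by move=> PAx; split=> //; exact: lagrange_omega_limit_neq0 (lag _ PAx).
  + by case.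
Qed.
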